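(* Let $G$ be a graph. If $G$ has finite local multiset dimension, then every clique $K$ of $G$ of order at least $3$ contains at most two $K$-end vertices. Moreover, if a clique $K$ of $G$ of order at least $3$ contains two $K$-end vertices, then exactly one of these two vertices belongs to every local multiset resolving set of $G$ (that is, every local multiset resolving set of $G$ contains exactly one of them).
   Context: All graphs are finite, connected, undirected and simple; $d(u,v)$ is the distance between $u$ and $v$. For a nonempty set $W\subseteq V(G)$ and a vertex $u\in V(G)$, the representation multiset $m(u|W)$ is the multiset of the distances $d(u,w)$, $w\in W$. $W$ is a local multiset resolving set of $G$ if $m(u|W)\neq m(v|W)$ for every two adjacent vertices $u,v$ of $G$. If $G$ has a local multiset resolving set, the smallest cardinality of one is the local multiset dimension $lmd(G)$; otherwise $G$ has infinite local multiset dimension. For $r\ge 3$, a vertex $u$ of a clique $K=K_r$ of $G$ is a $K$-end vertex if its degree in $G$ is $\deg_G(u)=r-1$. *)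

(* Defs.v *)
From HB Require Import structures.
From mathcomp Require Import all_boot.
From mathcomp Require Import finmap multiset.

Set Implicit Arguments.
Unset Strict Implicit.
Unset Printing Implicit Defensive.

Record connectedGraph := ConnectedGraph {
  vertex :> finType;
  adj : rel vertex;
  adj_sym : symmetric adj;
  adj_irrefl : irreflexive adj;
  adj_connected : forall u v, connect adj u v
}.

Arguments adj {c} _ _.

Definition walk (G : connectedGraph) (u v : G) (k : nat) : bool :=
  [exists p : k.-tuple G, path adj u p && (last u p == v)].

Lemma walk_ex (G : connectedGraph) (u v : G) : exists k, walk u v k.
Proof.
have /connectP [p path_p ->] := adj_connected u v.
by exists (size p); apply/existsP; exists (in_tuple p); rewrite /= path_p eqxx.
Qed.

Definition dist (G : connectedGraph) (u v : G) : nat := ex_minn (walk_ex u v).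

Local Open Scope mset_scope.

Definition rep_mset (G : connectedGraph) (u : G) (W : {set G}) : {mset nat} :=
  seq_mset [seq dist u w | w in W].

Definition local_mset_resolving (G : connectedGraph) (W : {set G}) : bool :=
  (W != set0) &&
  [forall u : G, forall v : G, adj u v ==> (rep_mset u W != rep_mset v W)].

(* [None] stands for an infinite local multiset dimension. *)
Definition lmd (G : connectedGraph) : option nat :=
  if [pick W : {set G} | local_mset_resolving W] is Some W0
  then Some #|[arg min_(W < W0 | local_mset_resolving W) #|W| ]|
  else None.

Definition finite_lmd (G : connectedGraph) : Prop := exists k, lmd G = Some k.

Definition deg (G : connectedGraph) (u : G) : nat := #|[set v | adj u v]|.

(* A clique need not be maximal. *)
Definition clique (G : connectedGraph) (K : {set G}) : bool :=
  [forall u in K, forall v in K, (u != v) ==> adj u v].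

(* Meant for cliques [K] of order at least 3. *)
Definition end_vertex (G : connectedGraph) (K : {set G}) (u : G) : bool :=
  (u \in K) && (deg u == #|K| - 1).

(* Main.v *)
Require Import Defs.
From HB Require Import structures.
From mathcomp Require Import all_boot.
From mathcomp Require Import finmap multiset.
From mathcomp Require Import perm.

Set Implicit Arguments.
Unset Strict Implicit.
Unset Printing Implicit Defensive.

(** Two distinct end vertices [u], [v] of a clique [K] have the same closed
    neighbourhood, namely [K], so exchanging them is an automorphism of the
    graph ([mono_adj_tperm]).  Automorphisms preserve distances, hence carry
    the representation of a vertex with respect to [W] to that of its image
    with respect to the image of [W] ([rep_mset_auto]).  If [W] contained both
    or neither of [u] and [v], the exchange would fix [W], and the adjacent
    vertices [u] and [v] would have equal representations; so a resolving set
    contains exactly one of them ([resolving_end_vertices]).  Among three end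
    vertices this is impossible by parity, and a finite dimension provides a
    resolving set to which the argument applies. *)

Lemma walk_dist (G : connectedGraph) (x y : G) : walk x y (dist x y).
Proof. by rewrite /dist; case: ex_minnP. Qed.

Lemma dist_le_walk (G : connectedGraph) (x y : G) k : walk x y k -> dist x y <= k.
Proof. by rewrite /dist; case: ex_minnP => m _; apply. Qed.

Lemma dist_homo (G H : connectedGraph) (f : G -> H) :
  {homo f : x y / adj x y} -> forall x y, dist (f x) (f y) <= dist x y.
Proof.
move=> f_adj x y; apply: dist_le_walk.
have /existsP [p /andP [path_p /eqP last_p]] := walk_dist x y.
apply/existsP; exists (map_tuple f p).
by rewrite /= last_map last_p eqxx andbT; apply: homo_path path_p.
Qed.

Lemma dist_auto (G : connectedGraph) (s : {perm G}) :
  {mono s : x y / adj x y} -> {mono s : x y / dist x y}.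
Proof.
move=> s_adj x y; apply/eqP; rewrite eqn_leq dist_homo => [|a b] /=; last first.
  by rewrite s_adj.
rewrite -{1}(permK s x) -{1}(permK s y).
apply: (dist_homo (f := (s^-1)%g)) => a b.
by rewrite -{1}(permKV s a) -{1}(permKV s b) s_adj.
Qed.

Lemma rep_mset_auto (G : connectedGraph) (s : {perm G}) :
  {mono s : x y / adj x y} ->
  forall (W : {set G}) x, rep_mset (s x) (s @: W) = rep_mset x W.
Proof.
move=> s_adj W x; apply/eq_seq_msetP.
have enum_imset : perm_eq (enum (s @: W)) (map s (enum W)).
  apply: uniq_perm; first exact: enum_uniq.
    by rewrite map_inj_uniq ?enum_uniq //; apply: perm_inj.
  move=> y; rewrite mem_enum; apply/imsetP/mapP => -[z zW ->].
    by exists z; rewrite ?mem_enum.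
  by exists z; rewrite // -mem_enum.
rewrite (permPl (perm_map _ enum_imset)) -map_comp.
by rewrite (eq_map (dist_auto s_adj x)).
Qed.

(** A clique already puts [#|K| - 1] neighbours around each of its vertices,
    so the degree condition leaves no room for a neighbour outside [K]. *)
Lemma adj_end_vertex (G : connectedGraph) (K : {set G}) u :
  clique K -> end_vertex K u -> forall w, adj u w = (w != u) && (w \in K).
Proof.
move=> /forall_inP clK /andP [uK /eqP deg_u] w.
have sub : K :\ u \subset [set x | adj u x].
  apply/subsetP => x; rewrite !inE => /andP [xu xK].
  by have /forall_inP/(_ x xK)/implyP := clK u uK; apply; rewrite eq_sym.
have /eqP/setP/(_ w) : K :\ u == [set x | adj u x].
  by rewrite eqEcard sub -/(deg u) deg_u (cardsD1 u K) uK addKn /=.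
by rewrite !inE => <-.
Qed.

(** The exchange maps the pair [u], [v] to itself, so only the edges joining
    [u] or [v] to a third vertex move, and twins have the same ones. *)
Lemma mono_adj_tperm (G : connectedGraph) (u v : G) :
  (forall w, w != u -> w != v -> adj u w = adj v w) ->
  {mono tperm u v : x y / adj x y}.
Proof.
move=> twin x y.
case: (tpermP u v x) => [->|->|/eqP xu /eqP xv];
  case: (tpermP u v y) => [->|->|/eqP yu /eqP yv];
  rewrite ?adj_irrefl //.
- exact: adj_sym.
- by rewrite twin.
- exact: adj_sym.
- by rewrite twin.
- by rewrite (adj_sym x u) (adj_sym x v) twin.
- by rewrite (adj_sym x u) (adj_sym x v) twin.
Qed.

Lemma resolving_end_vertices (G : connectedGraph) (K : {set G}) (u v : G)
    (W : {set G}) :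
  clique K -> u != v -> end_vertex K u -> end_vertex K v ->
  local_mset_resolving W -> (u \in W) (+) (v \in W).
Proof.
move=> clK uv endu endv /andP [_ /forallP /(_ u) /forallP /(_ v) /implyP resW].
have adj_u := adj_end_vertex clK endu; have adj_v := adj_end_vertex clK endv.
have /resW : adj u v by rewrite adj_u eq_sym uv; case/andP: endv.
have s_adj : {mono tperm u v : x y / adj x y}.
  by apply: mono_adj_tperm => w wu wv; rewrite adj_u adj_v wu wv.
apply: contraNT; rewrite negb_add => /eqP uvW.
(* The exchange fixes every vertex other than [u] and [v], and [uvW] says that
   these two lie on the same side of [W]. *)
have sW : tperm u v @: W = W.
  apply/setP => x; rewrite -{1}[x](tpermK u v) mem_imset; last exact: perm_inj.
  by case: tpermP => [->|->|].
by rewrite -(rep_mset_auto s_adj W u) sW tpermL.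
Qed.

Theorem theorem3 (G : connectedGraph) :
  (finite_lmd G ->
     forall K : {set G}, clique K -> 3 <= #|K| ->
       #|[set u | end_vertex K u]| <= 2)
  /\
  (forall K : {set G}, clique K -> 3 <= #|K| ->
     forall u v : G, u != v -> end_vertex K u -> end_vertex K v ->
       forall W : {set G}, local_mset_resolving W ->
         (u \in W) (+) (v \in W)).
Proof.
split=> [[k] | K clK _ u v uv endu endv W]; last first.
  exact: resolving_end_vertices clK uv endu endv.
rewrite /lmd; case: pickP => // W resW _ K clK _.
rewrite leqNgt; apply/negP => /card_gt2P [x [y [z]]].
rewrite !inE => -[[endx endy endz] [xy yz zx]].
move: (resolving_end_vertices clK xy endx endy resW).
move: (resolving_end_vertices clK yz endy endz resW).
move: (resolving_end_vertices clK zx endz endx resW).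
by case: (x \in W); case: (y \in W); case: (z \in W).
Qed.
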